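(* Let $D_{16}$ be the dihedral group of order $16$ presented by $\langle s,r\mid s^2=r^8=(sr)^2=1\rangle$. Then the subset $$Y=\{1,r,s,sr^3,sr^5,sr^7\}\subset D_{16}$$ is a $(16,6,2)$ pre-difference set, and $Y$ is not a difference set.
   Context: Let $G$ be a finite group and $Y\subset G$. For $a\in G$ let $[a]$ be its conjugacy class, $\lambda_a:=\#\{(x,y)\in Y\times Y\mid x^{-1}y=a\}$ and $\lambda_{[a]}:=\#\{(x,y)\in Y\times Y\mid x^{-1}y\in[a]\}$. A non-empty proper subset $Y$ of $G$ is a $(v,k,\lambda)$-difference set if $v=\#G$, $k=\#Y$ and $\lambda_a=\lambda$ for every $a\in G$, $a\ne1$. A non-empty subset $Y$ of $G$ is a $(v,k,\lambda)$ pre-difference set if $v=\#G$, $k=\#Y$ and $\lambda_{[a]}=\lambda\,\#[a]$ for every $a\in G$, $a\neq1$. $Y$ is a difference set if it is a $(v,k,\lambda)$-difference set for some $(v,k,\lambda)$. *)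

(* Defs.v *)
From mathcomp Require Import all_boot all_fingroup all_solvable.

Set Implicit Arguments.
Unset Strict Implicit.
Unset Printing Implicit Defensive.

Local Open Scope group_scope.

Section DifferenceSets.

Variables (gT : finGroupType) (G : {group gT}) (Y : {set gT}).

Definition lambda_elt (a : gT) : nat :=
  #|[set p in setX Y Y | p.1^-1 * p.2 == a]|.

Definition lambda_class (a : gT) : nat :=
  #|[set p in setX Y Y | p.1^-1 * p.2 \in a ^: G]|.

Definition difference_set_params (v k l : nat) : Prop :=
  [/\ Y != set0, Y \proper G, v = #|G|, k = #|Y|
    & forall a, a \in G -> a != 1 -> lambda_elt a = l].

Definition pre_difference_set_params (v k l : nat) : Prop :=
  [/\ Y != set0, Y \subset G, v = #|G|, k = #|Y|
    & forall a, a \in G -> a != 1 -> lambda_class a = (l * #|a ^: G|)%N].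

Definition difference_set : Prop :=
  exists v k l : nat, difference_set_params v k l.

End DifferenceSets.

(* [G \isog Grp (...)] binds its own generators, so it does not mention s and
   r: the remaining conditions say that s and r generate G and satisfy the
   relators.  The morphism from the presented group to G sending its
   generators to s and r is then onto, hence bijective since both groups have
   the same finite order, i.e., G is presented on s and r themselves. *)
Definition dihedral16_presentation (gT : finGroupType) (G : {group gT})
    (s r : gT) : Prop :=
  [/\ G \isog Grp (x : y : x ^+ 2, y ^+ 8, (x * y) ^+ 2),
      <<[set s; r]>> = G, s ^+ 2 = 1, r ^+ 8 = 1 & (s * r) ^+ 2 = 1].

(* Main.v *)
Require Import Defs.
From mathcomp Require Import all_boot all_fingroup all_solvable.

(** The relations allow every element of the group to be written [s ^+ e * r ^+ i]
    with [e < 2] and [i < 8].  Since the presentation maps onto the dihedral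
    group of order 16, the group has at least 16 elements, so these 16 normal
    forms are pairwise distinct ([uniq_normal_forms]) and equality of elements
    can be decided on the exponents.  The normal form of [x^-1 * y] is an explicit
    function [nf_ldiv] of those of [x] and [y] ([nf_eltV_mul]), and it determines
    conjugation as well.  Each cardinal in the statement is thereby a count over
    an explicit list of exponents ([card_quotients], [card_class_nf]), and the
    theorem becomes a finite computation on 16 pairs.

    For the given [Y], every non-trivial element is a quotient in two ways, except
    that [s] is one in four ways and [s * r ^+ 2] in none.  These two
    elements are conjugate, in a class of four elements on which the multiplicities
    4, 0, 2, 2 still average 2.  Hence [Y] is a pre-difference set, but not a
    difference set. *)

Local Open Scope group_scope.

(** * Exponents of the normal forms *)

(** The exponents are natural numbers, not elements of finite types, so
    that counts over lists of them evaluate. *)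
Definition nf_codes : seq (bool * nat) :=
  [seq (e, i) | e <- [:: false; true], i <- iota 0 8].

Definition nf_ldiv (c d : bool * nat) : bool * nat :=
  (c.1 (+) d.1, ((if c.1 (+) d.1 then c.2 else 8 - c.2) + d.2) %% 8).

(** Left division suffices to conjugate: with [c * g] written as
    [(c^-1 * 1)^-1 * g], the conjugate [g^-1 * (c * g)] is a nested quotient. *)
Definition nf_conj (g c : bool * nat) : bool * nat :=
  nf_ldiv g (nf_ldiv (nf_ldiv c (false, 0)) g).

Definition nf_in_class (c d : bool * nat) : bool :=
  has (fun g => d == nf_conj g c) nf_codes.

Lemma mem_nf_codes e i : ((e, i) \in nf_codes) = (i < 8).
Proof. by case: e; do 8?[case: i => [//|i]]. Qed.

Lemma nf_ldiv_codes c d : nf_ldiv c d \in nf_codes.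
Proof. by rewrite mem_nf_codes ltn_pmod. Qed.

(** * Normal forms in a group satisfying the relations *)

Definition nf_elt {gT : finGroupType} (s r : gT) (c : bool * nat) : gT :=
  s ^+ c.1 * r ^+ c.2.

(** The dihedral group of order 16 satisfies the presentation, hence is an image
    of every group that the presentation defines. *)
Lemma presentation_card_ge16 (gT : finGroupType) (G : {group gT}) :
  G \isog Grp (x : y : x ^+ 2, y ^+ 8, (x * y) ^+ 2) -> 16 <= #|G|.
Proof.
move=> isoG; have <- : #|'D_16| = 16 by apply: (@card_dihedral 8).
apply: leq_homg; rewrite isoG.
have /existsP[[x y] /=] := isoGrp_hom (@Grp_dihedral 8 isT).
rewrite !xpair_eqE.
case/and4P=> /eqP defG /eqP x8 /eqP y2 /eqP xy.
apply/existsP; exists (y, x); rewrite /= !xpair_eqE joingC defG x8 y2 !eqxx /=.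
have yV: y^-1 = y by apply/eqP; rewrite eq_invg_mul -y2.
by rewrite expgS expg1 -{1}yV mulgA -(mulgA _ x) -conjgE xy mulVg.
Qed.

Section NormalForms.

Variables (gT : finGroupType) (G : {group gT}) (s r : gT).
Hypotheses (s2 : s ^+ 2 = 1) (r8 : r ^+ 8 = 1) (sr2 : (s * r) ^+ 2 = 1).
Hypotheses (defG : <<[set s; r]>> = G) (geG16 : 16 <= #|G|).

Local Notation nf := (nf_elt s r).

Lemma nf_elt1 : nf (false, 0) = 1.
Proof. exact: mulg1. Qed.

Lemma sV : s^-1 = s.
Proof. by apply/eqP; rewrite eq_invg_mul -s2. Qed.

Lemma rotJ : r ^ s = r^-1.
Proof.
have rs2: (r * s) ^+ 2 = 1.
  by rewrite -[r * s](mulKg s) (mulgA s) -conjgE -conjXg sr2 conj1g.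
by apply/eqP; rewrite eq_sym eq_invg_mul conjgE sV mulgA -rs2.
Qed.

(** Inverting [s ^+ e * r ^+ i] gives [r ^- i * s ^+ e], and moving an odd power
    of [s] past [r ^- i] turns it into [r ^+ i]: hence the exponent [i] enters
    [nf_ldiv] negated exactly when the powers of [s] cancel. *)
Lemma nf_eltV_mul c d : c \in nf_codes -> (nf c)^-1 * nf d = nf (nf_ldiv c d).
Proof.
case: c d => e i [f j]; rewrite mem_nf_codes => /ltnW le_i8.
have rV: r ^- i = r ^+ (8 - i).
  by apply/eqP; rewrite eq_invg_mul -expgD subnKC // r8.
have rs: r ^- i * s = s * r ^+ i.
  by rewrite conjgC conjVg conjXg rotJ expgVn invgK.
rewrite /nf_elt /nf_ldiv /= expg_mod // expgD invMg !mulgA.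
case: e f => [] [] /=; rewrite ?expg0 ?invg1 ?sV ?expg1 ?mulg1 ?mul1g -?rV ?rs //.
by rewrite -rs -(mulgA _ s s) (s2 : s * s = 1) mulg1.
Qed.

Lemma nf_eltJ c g : c \in nf_codes -> g \in nf_codes ->
  nf c ^ nf g = nf (nf_conj g c).
Proof.
move=> Cc Cg; rewrite /nf_conj -!nf_eltV_mul ?nf_ldiv_codes //.
by rewrite nf_elt1 mulg1 invgK conjgE.
Qed.

Lemma nf_elt_onto x : x \in G -> x \in map nf nf_codes.
Proof.
have nRs: <[s]> \subset 'N(<[r]>).
  by rewrite cycle_subG; apply/normP; rewrite -cycleJ rotJ cycleV.
rewrite -defG -[<<_>>]/([set s] <*> [set r]) -joing_idl -joing_idr norm_joinEl //.
case/mulsgP=> _ _ /cycleP[k ->] /cycleP[j ->] ->; apply/mapP.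
exists (odd k, j %% 8); first by rewrite mem_nf_codes ltn_pmod.
by rewrite /nf_elt /= expg_mod // -modn2 expg_mod.
Qed.

Lemma nf_elt_in c : nf c \in G.
Proof. by rewrite -defG groupM ?groupX ?mem_gen ?inE ?eqxx ?orbT. Qed.

(** The list has 16 entries and covers a group of at least 16 elements. *)
Lemma uniq_normal_forms : uniq (map nf nf_codes).
Proof.
apply: (leq_size_uniq (enum_uniq G)); last by rewrite size_map -cardE.
by move=> x; rewrite mem_enum => /nf_elt_onto.
Qed.

Lemma card_normal_forms : #|G| = 16.
Proof.
rewrite -[16]/(size (map nf nf_codes)) -(card_uniqP uniq_normal_forms).
apply: eq_card => x; apply/idP/idP=> [/nf_elt_onto //|/mapP[c _ ->]].
exact: nf_elt_in.
Qed.

Lemma nf_elt_inj : {in nf_codes &, injective nf}.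
Proof.
move=> c d Cc Cd eq_cd; rewrite -(nth_index c Cc) -(nth_index c Cd).
congr nth; apply/eqP; rewrite -(nth_uniq 1 _ _ uniq_normal_forms);
  rewrite ?size_map ?index_mem //.
by rewrite !(nth_map c) ?index_mem // !nth_index // eq_cd.
Qed.

Lemma mem_class_nf c d : c \in nf_codes -> d \in nf_codes ->
  (nf d \in nf c ^: G) = nf_in_class c d.
Proof.
move=> Cc Cd; apply/imsetP/hasP=> [[x /nf_elt_onto/mapP[g Cg ->]] | [g Cg /eqP->]].
  by rewrite nf_eltJ // => /nf_elt_inj E; exists g; rewrite // E ?nf_ldiv_codes.
by exists (nf g); rewrite ?nf_elt_in ?nf_eltJ.
Qed.

Lemma card_class_nf c : c \in nf_codes ->
  #|nf c ^: G| = count (nf_in_class c) nf_codes.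
Proof.
move=> Cc; have sCG: nf c ^: G \subset G by rewrite class_subG ?nf_elt_in.
rewrite -(eq_in_count (fun d Cd => mem_class_nf c d Cc Cd)).
rewrite -(count_map nf (mem (nf c ^: G))) -size_filter.
rewrite -(card_uniqP (filter_uniq _ uniq_normal_forms)); apply: eq_card => x.
rewrite mem_filter inE /=; case: (boolP (x \in _)) => //= /(subsetP sCG).
by move/nf_elt_onto ->.
Qed.

Section Quotients.

Variable cs : seq (bool * nat).
Hypotheses (Ccs : {subset cs <= nf_codes}) (Ucs : uniq cs).

Lemma card_nf_set : #|[set:: map nf cs]| = size cs.
Proof.
rewrite cardsE (card_uniqP _) ?size_map // map_inj_in_uniq //.
by apply: sub_in2 nf_elt_inj.
Qed.

(** Both multiplicities in the definitions are counts of pairs by their quotient,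
    with [A] a single element or a conjugacy class. *)
Lemma card_quotients (A : pred gT) (P : pred (bool * nat)) :
    {in nf_codes, forall c, A (nf c) = P c} ->
  let Y := [set:: map nf cs] in
  #|[set p in setX Y Y | A (p.1^-1 * p.2)]| =
    count P [seq nf_ldiv c d | c <- cs, d <- cs].
Proof.
move=> AP Y; pose nf2 p := (nf p.1, nf p.2).
pose T := [seq (c, d) | c <- cs, d <- cs].
have memT p : p \in T -> p.1 \in cs /\ p.2 \in cs.
  by case/allpairsP=> q [? ? ->].
have UT: uniq (map nf2 T).
  rewrite map_inj_in_uniq; first by apply: allpairs_uniq => // -[? ?] [].
  move=> [a b] [c d] /memT[/= /Ccs ? /Ccs ?] /memT[/= /Ccs ? /Ccs ?] [].
  by move=> /nf_elt_inj-> // /nf_elt_inj->.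
have ->: [seq nf_ldiv c d | c <- cs, d <- cs] = [seq nf_ldiv p.1 p.2 | p <- T].
  by rewrite map_allpairs.
rewrite count_map; pose B p := A (p.1^-1 * p.2).
transitivity (count (preim nf2 B) T); last first.
  apply: eq_in_count => p /memT[Cp1 Cp2]; rewrite /B /= nf_eltV_mul ?Ccs //.
  by rewrite AP ?nf_ldiv_codes.
rewrite -count_map -size_filter -(card_uniqP (filter_uniq _ UT)).
apply: eq_card => -[x y]; rewrite mem_filter !inE /= andbC; congr (_ && _).
apply/andP/mapP=> [[/mapP[c ? ->] /mapP[d ? ->]] | [p /memT[? ?] [-> ->]]].
  by exists (c, d) => //; apply: allpairs_f.
by rewrite !map_f.
Qed.

Lemma lambda_elt_nf a : a \in nf_codes ->
  lambda_elt [set:: map nf cs] (nf a) =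
    count_mem a [seq nf_ldiv c d | c <- cs, d <- cs].
Proof.
move=> Ca; apply: (card_quotients (pred1 (nf a))) => c Cc /=.
by apply/eqP/eqP=> [/nf_elt_inj->|->].
Qed.

Lemma lambda_class_nf a : a \in nf_codes ->
  lambda_class G [set:: map nf cs] (nf a) =
    count (nf_in_class a) [seq nf_ldiv c d | c <- cs, d <- cs].
Proof.
by move=> Ca; apply: (card_quotients (mem (nf a ^: G))) => c; apply: mem_class_nf.
Qed.

End Quotients.

End NormalForms.

(** * The subset [Y] *)

Definition Y_codes : seq (bool * nat) :=
  [:: (false, 0); (false, 1%N); (true, 0); (true, 3); (true, 5); (true, 7)].

Theorem proposition4p1 (gT : finGroupType) (D16 : {group gT}) (s r : gT)
    (presD16 : dihedral16_presentation D16 s r) :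
  let Y := [set 1; r; s; s * r ^+ 3; s * r ^+ 5; s * r ^+ 7] in
  pre_difference_set_params D16 Y 16 6 2 /\ ~ difference_set D16 Y.
Proof.
case: presD16 => isoD16 defG s2 r8 sr2 Y.
have geG16 := presentation_card_ge16 _ _ isoD16.
have defY: Y = [set:: map (nf_elt s r) Y_codes].
  apply/setP=> x; rewrite !inE /nf_elt /= ?expg0 ?expg1 ?mulg1 ?mul1g.
  by rewrite -!orbA ?orbF.
have sYC: {subset Y_codes <= nf_codes} by apply/allP.
have UY: uniq Y_codes by [].
have onto := nf_elt_onto _ _ _ _ s2 r8 sr2 defG.
split.
  split.
  - by apply/set0Pn; exists 1; rewrite !inE eqxx.
  - apply/subsetP=> x; rewrite defY inE => /mapP[c _ ->].
    exact: nf_elt_in defG c.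
  - by rewrite (card_normal_forms _ D16 s r).
  - by rewrite defY (card_nf_set _ D16).
  move=> a /onto/mapP[c Cc ->] nt_c; rewrite defY.
  rewrite (lambda_class_nf _ D16) // (card_class_nf _ D16) //.
  (* The remaining identity is checked by evaluation on the 16 codes. *)
  have /allP/(_ c Cc)/implyP := isT : all (fun c => (c != (false, 0)) ==>
    (count (nf_in_class c) [seq nf_ldiv x y | x <- Y_codes, y <- Y_codes] ==
       2 * count (nf_in_class c) nf_codes)%N) nf_codes.
  move=> H; apply/eqP/H; apply: contraNneq nt_c => ->.
  by rewrite nf_elt1.
case=> v [k [l [_ _ _ _ lam]]].
have lam_nf a : a \in nf_codes -> a != (false, 0) ->
    count_mem a [seq nf_ldiv x y | x <- Y_codes, y <- Y_codes] = l.
  move=> Ca nt_a; rewrite -(lambda_elt_nf _ D16 s r) // -defY.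
  apply: lam; first exact: nf_elt_in defG a.
  apply: contraNneq nt_a => a1; apply/eqP.
  apply: (nf_elt_inj _ D16 s r) => //.
  by rewrite a1 nf_elt1.
(* [s] is a quotient in four ways, [s * r ^+ 2] in none. *)
have := lam_nf (true, 0) isT isT.
by rewrite -(lam_nf (true, 2) isT isT).
Qed.
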